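(* Let $n\ge1$, $L>0$, let $f:\mathbb R^n\to\mathbb R$ be convex and $L$-smooth, let $h:\mathbb R^n\to\mathbb R\cup\{+\infty\}$ be proper, lower semicontinuous, convex and possibly nonsmooth, and let $F=f+h$. Suppose $F$ attains its minimum at some $\mathbf{x}^*$ with $F^*=F(\mathbf{x}^* )>-\infty$. Let $p\ge3$ and let $(\mathbf{x}_k)$ be generated by the NSA algorithm for composite objectives (described in the context) with $\alpha_k=\frac{p}{k+p}$ and step size $\eta=\frac1L$. Let $\delta_k=F(\mathbf{x}_k)-F^*$. Then $$\lim_{k\to\infty}k^2\delta_k=0.$$
   Context: $L$-smooth means continuously differentiable with $L$-Lipschitz gradient. The proximal operator is $\mathbf{prox}_{\eta,h}(\mathbf{x})=\arg\min_{\mathbf{y}\in\mathbb R^n}\{h(\mathbf{y})+\frac{1}{2\eta}\|\mathbf{y}-\mathbf{x}\|^2\}$. NSA for composite objectives: pick $\mathbf{x}_0=\mathbf{z}_0\in\mathbb R^n$ (such that $0\notin\partial F(\mathbf{x}_0)$). For $k=0,1,2,\dots$ set $$\mathbf{y}_k=(1-\alpha_k)\mathbf{x}_k+\alpha_k\mathbf{z}_k,\quad \mathbf{x}_{k+1}'=\mathbf{prox}_{\eta,h}(\mathbf{y}_k-\eta\nabla f(\mathbf{y}_k)),\quad \mathbf{x}_{k+1}''=\mathbf{prox}_{\eta,h}(\mathbf{x}_k-\eta\nabla f(\mathbf{x}_k)),$$ $$\mathbf{x}_{k+1}=\begin{cases}\mathbf{x}_{k+1}'&\text{if }F(\mathbf{x}_{k+1}')\le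 F(\mathbf{x}_{k+1}''),\\ \mathbf{x}_{k+1}''&\text{otherwise,}\end{cases}\qquad \mathbf{z}_{k+1}=\mathbf{z}_k-\frac{\eta}{\alpha_k}\nabla f(\mathbf{y}_k)-\frac{\eta}{\alpha_k}\mathbf{g}_{k+1}',$$ where $\mathbf{g}_{k+1}'$ is defined by $\eta\,\mathbf{g}_{k+1}'=\mathbf{y}_k-\eta\nabla f(\mathbf{y}_k)-\mathbf{x}_{k+1}'$. *)

(* Defs.v *)
From HB Require Import structures.
From mathcomp Require Import all_boot all_order all_algebra.
From mathcomp Require Import all_classical all_reals all_analysis.
Set Implicit Arguments.
Unset Strict Implicit.
Unset Printing Implicit Defensive.
Import Order.TTheory GRing.Theory Num.Theory.
Import numFieldNormedType.Exports.
Local Open Scope classical_set_scope.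
Local Open Scope ring_scope.

(* The canonical norm of 'rV[R]_n in the library is the sup norm, so the
   Euclidean structure is introduced explicitly. Both norms induce the same
   topology and the same notion of differentiability. *)
Definition dot {R : realType} {n : nat} (u v : 'rV[R]_n) : R :=
  \sum_(i < n) u 0 i * v 0 i.

Definition enorm {R : realType} {n : nat} (u : 'rV[R]_n) : R :=
  Num.sqrt (dot u u).

Definition grad {R : realType} {n : nat} (f : 'rV[R]_n -> R) (x : 'rV[R]_n) :
    'rV[R]_n :=
  \row_i 'D_(delta_mx 0 i) f x.

Definition L_smooth {R : realType} {n : nat} (L : R) (f : 'rV[R]_n -> R) : Prop :=
  [/\ forall x, differentiable f x,
      continuous (grad f) &
      forall x y, enorm (grad f x - grad f y) <= L * enorm (x - y)].

Definition proper_fun {R : realType} {n : nat} (h : 'rV[R]_n -> \bar R) : Prop :=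
  (forall x, h x != -oo%E) /\ (exists x, h x != +oo%E).

(* When h never takes the value -oo, the convention 0 * +oo = 0 makes the
   inequality trivial at t = 0 and t = 1, as it should be. *)
Definition econvex {R : realType} {n : nat} (h : 'rV[R]_n -> \bar R) : Prop :=
  forall (x y : 'rV[R]_n) (t : R), 0 <= t <= 1 ->
    (h (t *: x + (1 - t) *: y)%R <= t%:E * h x + (1 - t)%:E * h y)%E.

Definition subdifferential {R : realType} {n : nat} (F : 'rV[R]_n -> \bar R)
    (x : 'rV[R]_n) : set 'rV[R]_n :=
  [set g | forall y, (F x + (dot g (y - x)%R)%:E <= F y)%E].

Definition argmin {R : realType} {n : nat} (G : 'rV[R]_n -> \bar R) :
    set 'rV[R]_n :=
  [set y | forall w, (G y <= G w)%E].

(* The default value 0 of xget is irrelevant: for h proper, lower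
   semicontinuous and convex and eta > 0 the argmin is a singleton. *)
Definition prox {R : realType} {n : nat} (eta : R) (h : 'rV[R]_n -> \bar R)
    (x : 'rV[R]_n) : 'rV[R]_n :=
  xget 0 (argmin (fun y => (h y + ((2 * eta)^-1 * enorm (y - x)%R ^+ 2)%:E)%E)).

Definition composite {R : realType} {n : nat} (f : 'rV[R]_n -> R)
    (h : 'rV[R]_n -> \bar R) (x : 'rV[R]_n) : \bar R :=
  ((f x)%:E + h x)%E.

(* The entries of x', x'' and g' at index 0 are unconstrained and unused. *)
Definition NSA {R : realType} {n : nat} (f : 'rV[R]_n -> R)
    (h : 'rV[R]_n -> \bar R) (eta : R) (alpha : nat -> R)
    (x y z x' x'' g' : nat -> 'rV[R]_n) : Prop :=
  [/\ x 0%N = z 0%N,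
      ~ subdifferential (composite f h) (x 0%N) 0 &
      forall k : nat,
        [/\ y k = (1 - alpha k) *: x k + alpha k *: z k,
            x' k.+1 = prox eta h (y k - eta *: grad f (y k)) /\
            x'' k.+1 = prox eta h (x k - eta *: grad f (x k)),
            x k.+1 = (if (composite f h (x' k.+1) <= composite f h (x'' k.+1))%E
                      then x' k.+1 else x'' k.+1),
            eta *: g' k.+1 = y k - eta *: grad f (y k) - x' k.+1 &
            z k.+1 = z k - (eta / alpha k) *: grad f (y k)
                     - (eta / alpha k) *: g' k.+1]].

(* Main.v *)
Require Import Defs.
From HB Require Import structures.
From mathcomp Require Import all_boot all_order all_algebra.
From mathcomp Require Import all_classical all_reals all_analysis.
From mathcomp Require Import ring lra.
Set Implicit Arguments.
Unset Strict Implicit.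
Unset Printing Implicit Defensive.
Import Order.TTheory GRing.Theory Num.Theory.
Import numFieldNormedType.Exports.
Local Open Scope classical_set_scope.
Local Open Scope ring_scope.

(* The energy E_k = delta_k / alpha_(k-1)^2 + L/2 |z_k - x*|^2 drops by at
   least k delta_k / p^2 at every step k >= 1: combine the prox-gradient
   inequality from y_k at the two points x_k and x* with weights 1 - alpha_k
   and alpha_k. Hence sum_k k delta_k is finite. The safeguard
   F(x_(k+1)) <= F(x''_(k+1)) <= F(x_k) makes delta nonincreasing, and for a
   nonincreasing nonnegative sequence summability of k delta_k forces
   k^2 delta_k -> 0. Step 0 is skipped, since F(x_0) may be +oo. *)

(** * The Euclidean inner product on row vectors *)

Section Dot.
Context {R : realType} {n : nat}.
Implicit Types (u v w : 'rV[R]_n) (c : R).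

Lemma dotC u v : dot u v = dot v u.
Proof. by apply: eq_bigr => i _; rewrite mulrC. Qed.

Lemma dotDl u v w : dot (u + v) w = dot u w + dot v w.
Proof. by rewrite /dot -big_split; apply: eq_bigr => i _; rewrite mxE mulrDl. Qed.

Lemma dotZl c u v : dot (c *: u) v = c * dot u v.
Proof. by rewrite /dot mulr_sumr; apply: eq_bigr => i _; rewrite mxE mulrA. Qed.

Lemma dotNl u v : dot (- u) v = - dot u v.
Proof. by rewrite -scaleN1r dotZl mulN1r. Qed.

Lemma dotDr u v w : dot u (v + w) = dot u v + dot u w.
Proof. by rewrite dotC dotDl !(dotC u). Qed.

Lemma dotZr c u v : dot u (c *: v) = c * dot u v.
Proof. by rewrite dotC dotZl (dotC u). Qed.

Lemma dotNr u v : dot u (- v) = - dot u v.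
Proof. by rewrite dotC dotNl (dotC u). Qed.

Definition dotE := (dotDl, dotDr, dotNl, dotNr, dotZl, dotZr).

Lemma dot_ge0 u : 0 <= dot u u.
Proof. by apply: sumr_ge0 => i _; rewrite -expr2 sqr_ge0. Qed.

Lemma enorm_sqr u : enorm u ^+ 2 = dot u u.
Proof. by rewrite sqr_sqrtr ?dot_ge0. Qed.

(** Passes from Euclidean estimates to the entrywise ones of the sup norm. *)
Lemma coord_le_dot u i : u 0 i ^+ 2 <= dot u u.
Proof.
by rewrite /dot (bigD1 i)//= -expr2 lerDl sumr_ge0// => j _; rewrite -expr2 sqr_ge0.
Qed.

Lemma cvg_dot {T : Type} {F : set_system T} {FF : Filter F}
    (u_ : T -> 'rV[R]_n) (a l : 'rV[R]_n) :
  u_ @ F --> l ->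
  dot (u_ k - a) (u_ k - a) @[k --> F] --> dot (l - a) (l - a).
Proof.
move=> ul; apply: (@cvg_big _ _ +%R) => [|i _]; first exact: add_continuous.
have cu : (u_ k - a) 0 i @[k --> F] --> (l - a) 0 i.
  rewrite (_ : (fun k => _) = (fun k => u_ k 0 i - a 0 i)); last first.
    by apply/funext => v; rewrite !mxE.
  rewrite !mxE; apply: cvgB; last exact: cvg_cst.
  exact: cvg_comp ul (@coord_continuous R 1 n 0 i l).
exact: cvgM.
Qed.

(** Cauchy-Schwarz in a form free of square roots: expand [dot (v - c *: u) (v - c *: u) >= 0]. *)
Lemma dot_le_scale u v c :
  0 < c -> dot v v <= c ^+ 2 * dot u u -> dot v u <= c * dot u u.
Proof.
move=> c0 vu; have := dot_ge0 (v - c *: u).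
rewrite !dotE (dotC u v) => H.
rewrite -(ler_pM2l c0); lra.
Qed.

End Dot.

(** * Smooth convex functions: first-order lower and upper bounds *)

Section Smooth.
Context {R : realType} {n : nat} (f : 'rV[R]_n -> R).

Lemma derive_grad x d : differentiable f x -> 'D_d f x = dot (grad f x) d.
Proof.
move=> df; rewrite deriveE// {1}(row_sum_delta d) linear_sum.
apply: eq_bigr => i _; rewrite linearZ/= mxE deriveE//.
by rewrite mulrC.
Qed.

Lemma is_derive_line x d t : differentiable f (x + t *: d) ->
  is_derive t 1 (fun s : R => f (x + s *: d)) (dot (grad f (x + t *: d)) d).
Proof.
move=> df.
(* The difference quotient at [t] along the line is the one of [f] at [x + t *: d] in direction
   [d]. *)
have E : (fun h : R => h^-1 *: (f (x + (h *: 1 + t) *: d) - f (x + t *: d))) =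
    (fun h : R => h^-1 *: (f (h *: d + (x + t *: d)) - f (x + t *: d))).
  apply/funext => h; congr (_ *: (f _ - _)).
  by rewrite scalerDl addrCA; congr (_ *: _ + _); rewrite [_ *: _]mulr1.
split; first by rewrite /derivable/= E; exact: diff_derivable.
by rewrite -derive_grad// /derive/= E.
Qed.

Hypothesis f_diff : forall x : 'rV[R]_n, differentiable f x.

(** By convexity the difference quotients from [y] towards [w] with step in (0, 1] are at most
    [f w - f y]; let the step tend to 0 from the right. *)
Lemma convex_grad_le : convex_function setT f ->
  forall y w, f y + dot (grad f y) (w - y) <= f w.
Proof.
move=> fc y w; rewrite -lerBrDl -derive_grad//.
have /cvg_dnbhs_at_right : h^-1 *: ((f \o shift y) (h *: (w - y)) - f y)
    @[h --> (0 : R)^'] --> 'D_(w - y) f y.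
  exact: (diff_derivable (f_diff y)).
move=> /cvgr_to_le; apply.
near=> t.
have t0 : 0 < t by near: t; exact: nbhs_right_gt.
have t1 : t <= 1 by near: t; exact: nbhs_right_le.
rewrite [_ *: _]mulrC ler_pdivrMr//= mulrC.
have : f (t *: w + (1 - t) *: y) <= t * f w + (1 - t) * f y.
  exact: (fc (Itv01 (ltW t0) t1) w y (in_setT _) (in_setT _)).
have -> : t *: w + (1 - t) *: y = t *: (w - y) + y.
  by rewrite scalerBl scale1r scalerBr addrA addrAC.
by lra.
Unshelve. all: by end_near. Qed.

Variable L : R.
Hypotheses (L0 : 0 < L)
  (fL : forall x y, enorm (grad f x - grad f y) <= L * enorm (x - y)).

(** The mean value theorem for [g], which is [f] along the segment minus linear and quadratic terms,
    replaces the usual integration: its derivative [dg] is nonpositive at positive [t]. *)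
Lemma descent_lemma y w :
  f w <= f y + dot (grad f y) (w - y) + L / 2 * dot (w - y) (w - y).
Proof.
set d := w - y.
pose c := dot (grad f y) d; pose q := L / 2 * dot d d.
pose g (t : R) := f (y + t *: d) - (t * c + t ^+ 2 * q).
pose dg (t : R) := dot (grad f (y + t *: d)) d - (c + t * (L * dot d d)).
have gD (t : R^o) : is_derive t 1 g (dg t).
  have ? := is_derive_line (f_diff (y + t *: d)).
  apply: is_derive_eq; rewrite /dg /q !scaler0 add0r /GRing.scale/=.
  by field.
have [t] : exists2 t, t \in `]0, 1[%R & g 1 - g 0 = dg t * (1 - 0).
  apply: MVT => //; apply: derivable_within_continuous => t _.
  exact: ex_derive.
rewrite in_itv/= => /andP[t0 _].
rewrite /g /dg scale1r scale0r addr0 (_ : y + d = w); last by rewrite addrC subrK.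
suff : dot (grad f (y + t *: d) - grad f y) d <= L * t * dot d d.
  rewrite dotDl dotNl -/c /q; lra.
apply: dot_le_scale; first exact: mulr_gt0.
have -> : (L * t) ^+ 2 * dot d d = (L * enorm (t *: d)) ^+ 2.
  by rewrite [in RHS]exprMn enorm_sqr dotZl dotZr; ring.
rewrite -enorm_sqr ler_pXn2r ?nnegrE ?mulr_ge0 ?sqrtr_ge0 ?(ltW L0)//.
have := fL (y + t *: d) y.
by rewrite (_ : y + t *: d - y = t *: d)// addrC addKr.
Qed.

End Smooth.

(** Let [t] tend to 0; concretely, [t = - a / (b - a)] gives a negative value if [a < 0]. *)
Lemma ge0_of_affine_ge0 {R : realFieldType} (a b : R) : 0 <= b ->
  (forall t, 0 < t -> t <= 1 -> 0 <= a + t * b) -> 0 <= a.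
Proof.
move=> b0 H; rewrite leNgt; apply/negP => a0.
have ba : 0 < b - a by lra.
have := H (- a / (b - a)); rewrite divr_gt0 ?ler_pdivrMr ?mul1r//; last by lra.
move=> /(_ isT) /(_ ltac:(lra)).
have -> : a + - a / (b - a) * b = - (a ^+ 2 / (b - a)) by field; lra.
by rewrite oppr_ge0 leNgt divr_gt0// exprn_even_gt0//= lt_eqF.
Qed.

(** * Proximal points: the optimality condition *)

Section Prox.
Context {R : realType} {n : nat} (h : 'rV[R]_n -> \bar R).
Hypotheses (h_proper : proper_fun h) (h_convex : econvex h).

Lemma econvex_fin u v a b t : h u = a%:E -> h v = b%:E -> 0 <= t <= 1 ->
  exists2 r, h (t *: u + (1 - t) *: v) = r%:E & r <= t * a + (1 - t) * b.
Proof.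
move=> hu hv t01; have := h_convex u v t01; rewrite hu hv -!EFinM -EFinD.
have := h_proper.1 (t *: u + (1 - t) *: v).
by case: (h _) => // r _; rewrite lee_fin => ?; exists r.
Qed.

(** First-order optimality: [eta^-1 *: (c - x)] is a subgradient of [h] at [x]. Compare [x] with
    [t *: w + (1 - t) *: x], divide by [t] and let [t] tend to 0. *)
Lemma argmin_moreau_subgrad (eta : R) (c x : 'rV[R]_n) : 0 < eta ->
  argmin (fun y => (h y + ((2 * eta)^-1 * enorm (y - c)%R ^+ 2)%:E)%E) x ->
  exists2 r, h x = r%:E &
    forall w s, h w = s%:E -> r + eta^-1 * dot (c - x) (w - x) <= s.
Proof.
move=> eta0 xmin.
have [w0 hw0] := h_proper.2.
have [r hx] : exists r, h x = r%:E.
  have := xmin w0; have := h_proper.1 x; move: hw0 (h_proper.1 w0).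
  by case: (h w0) => // s _ _; case: (h x) => // r _ _; exists r.
exists r => // w s hw.
pose a := (2 * eta)^-1.
have a0 : 0 < a by rewrite invr_gt0 mulr_gt0.
have aE : eta^-1 = 2 * a by rewrite /a; field; rewrite gt_eqF.
suff : 0 <= s - r + 2 * a * dot (x - c) (w - x).
  by rewrite aE -[c - x]opprB dotNl; lra.
apply: (@ge0_of_affine_ge0 _ _ (a * dot (w - x) (w - x))).
  by rewrite mulr_ge0 ?dot_ge0 ?ltW.
move=> t t0 t1; have [|q hq qle] := econvex_fin hw hx (t := t).
  by rewrite ltW.
have := xmin (t *: w + (1 - t) *: x).
rewrite hx hq -!EFinD lee_fin !enorm_sqr -/a.
have -> : t *: w + (1 - t) *: x - c = (x - c) + t *: (w - x).
  by apply/rowP => i; rewrite !mxE; ring.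
rewrite -(pmulr_rge0 _ t0).
move: (x - c) (w - x) => u v; rewrite !dotE (dotC v u) => H.
lra.
Qed.

End Prox.

(** * Proximal points: existence by the direct method *)

Section ProxExists.
Context {R : realType} {n : nat} (h : 'rV[R]_n -> \bar R).
Hypotheses (h_proper : proper_fun h) (h_convex : econvex h).
Hypothesis h_lsc : lower_semicontinuous h.

(** A minimizing sequence converges because the quadratic term is strongly convex, and lower
    semicontinuity makes its limit a minimizer. *)
Lemma argmin_moreau_neq0 (a : R) (c : 'rV[R]_n) (m0 : R) : 0 < a ->
  (forall w, (m0%:E <= h w + (a * enorm (w - c) ^+ 2)%:E)%E) ->
  argmin (fun y => (h y + (a * enorm (y - c)%R ^+ 2)%:E)%E) !=set0.
Proof.
move=> a0 m0P.
pose q w := a * dot (w - c) (w - c).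
(* Only points where [h] is finite contribute, so that the infimum is a real number. *)
pose S := [set s : R | exists w r, h w = r%:E /\ s = r + q w].
have GE w r : h w = r%:E -> (h w + (a * enorm (w - c) ^+ 2)%:E = (r + q w)%:E)%E.
  by move=> ->; rewrite enorm_sqr -EFinD.
have Slb : lbound S m0.
  by move=> _ [w [r [hw ->]]]; have := m0P w; rewrite (GE _ _ hw) lee_fin.
have Sinf : has_inf S.
  split; last by exists m0.
  have [w hw] := h_proper.2; have := h_proper.1 w.
  by case E: (h w) hw => [r| |]// _ _; exists (r + q w), w, r.
pose m := inf S.
have mle w r : h w = r%:E -> m <= r + q w.
  by move=> hw; apply: ge_inf; [exists m0|exists w, r].
have near_min (k : nat) :
    exists w, exists2 r, h w = r%:E & r + q w < m + k.+1%:R^-1.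
  have [|_ [w [r [hw ->]]] ?] := inf_adherent _ Sinf (eps := k.+1%:R^-1).
    by rewrite invr_gt0 ltr0n.
  by exists w, r.
have [u uP] := choice near_min.
(* Parallelogram identity: at the midpoint [q] falls below the average by
   [a / 4 * dot (w - w') (w - w')], while the objective there is still at least [m]. *)
have close e w r w' r' : h w = r%:E -> h w' = r'%:E ->
    r + q w < m + e -> r' + q w' < m + e ->
    a / 4 * dot (w - w') (w - w') < e.
  move=> hw hw' we we'.
  have [|s hs sle] := econvex_fin h_proper h_convex hw hw' (t := 2^-1).
    by rewrite invr_ge0 ler0n invf_le1 ?ler1n.
  have := mle _ _ hs.
  have -> : q (2^-1 *: w + (1 - 2^-1) *: w') =
      (q w + q w') / 2 - a / 4 * dot (w - w') (w - w').
    rewrite /q.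
    have -> : 2^-1 *: w + (1 - 2^-1) *: w' - c = 2^-1 *: ((w - c) + (w' - c)).
      by apply/rowP => i; rewrite !mxE; field.
    have -> : w - w' = (w - c) - (w' - c) by rewrite opprB addrA subrK.
    by move: (w - c) (w' - c) => z z'; rewrite !dotE (dotC z' z); field.
  by move: sle we we'; lra.
(* Strong convexity makes the minimizing sequence Cauchy. *)
have ucvg : cvg (u @ \oo).
  apply: mx_complete; apply: cauchy_exP => e e0.
  have a4 : 0 < a / 4 by rewrite divr_gt0.
  have a4e : 0 < a / 4 * e ^+ 2 by rewrite mulr_gt0 ?exprn_gt0.
  have [N _ NP] := near_infty_natSinv_lt (PosNum a4e).
  have {}NP k : (N <= k)%N -> k.+1%:R^-1 < a / 4 * e ^+ 2 by move=> /NP.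
  exists (u N); exists N => // k /= Nk; split => // i j.
  rewrite ord1 -ball_normE /ball_/=.
  have [r hr rle] := uP N; have [s hs sle] := uP k.
  have d : dot (u N - u k) (u N - u k) < e ^+ 2.
    rewrite -(ltr_pM2l a4).
    by apply: (close _ _ _ _ _ hr hs);
      [apply: (lt_trans rle)|apply: (lt_trans sle)]; rewrite ltrD2l NP.
  have : `|u N 0 j - u k 0 j| ^+ 2 < e ^+ 2.
    rewrite real_normK ?num_real//; apply: le_lt_trans d.
    by have := coord_le_dot (u N - u k) j; rewrite !mxE.
  by rewrite ltr_pXn2r ?nnegrE ?normr_ge0// ltW.
pose l := lim (u @ \oo).
(* If [h l] exceeded the bound by more than [e], so would [h (u k)] for large [k]; but [u k] is
   [e / 2]-minimal and [q (u k)] is within [e / 2] of [q l]. *)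
have hl : (h l <= (m - q l)%:E)%E.
  apply/lee_addgt0Pr => e e0; rewrite -EFinD leNgt; apply/negP => /h_lsc[V lV hV].
  have e2 : 0 < e / 2 by rewrite divr_gt0.
  near \oo => k.
  have [r hr rle] := uP k.
  have : ((m - q l + e)%:E < h (u k))%E.
    by apply: hV; near: k; exact: ucvg.
  rewrite hr lte_fin => rgt.
  have {}rle : r + q (u k) < m + e / 2.
    apply: (lt_trans rle); rewrite ltrD2l.
    by near: k; exact: (near_infty_natSinv_lt (PosNum e2)).
  have : `|q l - q (u k)| < e / 2.
    near: k; apply: cvgr_dist_lt e2; apply: cvgMr; exact: cvg_dot ucvg.
  by rewrite ltr_norml => /andP[]; lra.
exists l => w.
have [r hlr] : exists r, h l = r%:E.
  by have := h_proper.1 l; case: (h l) hl => // r; exists r.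
rewrite (GE _ _ hlr); have := h_proper.1 w.
case hw: (h w) => [s| |]// _; last by rewrite addye// leey.
rewrite -hw (GE _ _ hw) lee_fin.
by apply: le_trans (mle _ _ hw); move: hl; rewrite hlr lee_fin; lra.
Unshelve. all: by end_near. Qed.

(** Existence of a minimizer ensures that [xget] does not fall back on its default 0. *)
Lemma argmin_prox (eta : R) (c : 'rV[R]_n) (m0 : R) : 0 < eta ->
  (forall w, (m0%:E <= h w + ((2 * eta)^-1 * enorm (w - c)%R ^+ 2)%:E)%E) ->
  argmin (fun y => (h y + ((2 * eta)^-1 * enorm (y - c)%R ^+ 2)%:E)%E)
    (prox eta h c).
Proof.
move=> eta0 m0P; apply: xgetPex.
by apply: (@argmin_moreau_neq0 _ _ m0) => //; rewrite invr_gt0 mulr_gt0.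
Qed.

End ProxExists.

(** * The proximal gradient inequality *)

Section ProxGradient.
Context {R : realType} {n : nat} (f : 'rV[R]_n -> R) (h : 'rV[R]_n -> \bar R).
Variable L : R.
Hypotheses (L0 : 0 < L) (f_convex : convex_function setT f).
Hypothesis f_smooth : L_smooth L f.
Hypotheses (h_proper : proper_fun h) (h_lsc : lower_semicontinuous h).
Hypothesis h_convex : econvex h.
Variables (xs : 'rV[R]_n) (xs_min : argmin (composite f h) xs).

Lemma composite_argmin_fin : exists r, composite f h xs = r%:E.
Proof.
have [w hw] := h_proper.2; have := xs_min w; have := h_proper.1 xs.
rewrite /composite; move: hw (h_proper.1 w).
case: (h w) => // s _ _; case: (h xs) => // r _ _.
by exists (f xs + r).
Qed.

(** Adds up the descent lemma from [y] to [x], the gradient inequality from [y] to [w], and the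
    subgradient inequality of [h] from [x] to [w]. *)
Lemma prox_gradient_step y (x := prox L^-1 h (y - L^-1 *: grad f y)) :
  exists2 r, composite f h x = r%:E &
    forall w s, composite f h w = s%:E ->
      r <= s + L * dot (y - x) (y - w) - L / 2 * dot (y - x) (y - x).
Proof.
have [f_diff _ fL] := f_smooth.
have Li0 : 0 < L^-1 by rewrite invr_gt0.
have [ms msle] : exists ms : R, forall w, (ms%:E <= composite f h w)%E.
  have [Fs E] := composite_argmin_fin.
  by exists Fs => w; rewrite -E.
(* The prox objective is at least [ms - f y]: its quadratic term at [w], once expanded, is the
   descent bound for [f w - f y] plus a nonnegative multiple of the squared gradient norm. *)
have := @argmin_prox R n h h_proper h_convex h_lsc L^-1 (y - L^-1 *: grad f y)
  (ms - f y) Li0.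
rewrite -/x => /(_ _)/(argmin_moreau_subgrad h_proper h_convex Li0)[w|r hx sub].
  have := msle w; rewrite /composite; have := h_proper.1 w.
  case: (h w) => [r| |]// _; last by move=> _; rewrite addye// leey.
  rewrite -!EFinD !lee_fin enorm_sqr.
  have := descent_lemma f_diff L0 fL y w.
  have -> : w - (y - L^-1 *: grad f y) = (w - y) + L^-1 *: grad f y.
    by apply/rowP => i; rewrite !mxE; ring.
  move: (w - y) (grad f y) => d g; rewrite !dotE (dotC g d) => H1 H2.
  have := dot_ge0 g => H3.
  have -> : (2 * L^-1)^-1 = L / 2 by field; rewrite gt_eqF.
  have -> : L / 2 * (dot d d + L^-1 * dot d g +
      (L^-1 * dot d g + L^-1 * (L^-1 * dot g g)))
    = L / 2 * dot d d + dot d g + L^-1 / 2 * dot g g.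
    by field; rewrite gt_eqF.
  have : 0 <= L^-1 / 2 * dot g g by rewrite mulr_ge0// divr_ge0// ltW.
  lra.
exists (f x + r); first by rewrite /composite hx.
move=> w s; rewrite /composite; have := h_proper.1 w.
case hw: (h w) => [t| |]// _ [<-].
have := sub _ _ hw; have := convex_grad_le f_diff f_convex y w.
have := descent_lemma f_diff L0 fL y x; rewrite invrK.
have -> : y - L^-1 *: grad f y - x = (y - x) - L^-1 *: grad f y.
  by apply/rowP => i; rewrite !mxE; ring.
have -> : w - x = (y - x) - (y - w).
  by apply/rowP => i; rewrite !mxE; ring.
have -> : x - y = - (y - x) by rewrite opprB.
have -> : w - y = - (y - w) by rewrite opprB.
move: (y - x) (y - w) (grad f y) => u v g.
have -> : L * dot (u - L^-1 *: g) (u - v) =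
    L * dot u u - dot g u - L * dot u v + dot g v.
  by rewrite !dotE; field; rewrite gt_eqF.
rewrite !dotE; lra.
Qed.

End ProxGradient.

(** Summing the drops of [E] from [M] to [N - 1], with [d] nonincreasing, bounds [c * d N] times a
    sum of order [N ^ 2] by [E M - E N], which is small once [E M] is near the infimum of [E]. *)
Lemma sqr_weighted_cvg0 {R : realType} (c : R) (d E : nat -> R) : 0 < c ->
  (forall k, 0 <= d k) -> (forall k, 0 <= E k) -> (forall k, d k.+1 <= d k) ->
  (forall k, E k.+1 + c * k.+1%:R * d k <= E k) ->
  k.+1%:R ^+ 2 * d k @[k --> \oo] --> 0.
Proof.
move=> c0 d0 E0 dS ES.
(* The fraction is the closed form of the sum of [k + 1] over [M <= k < M + j]. *)
have tail M j : c * d (M + j)%N *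
    (((M + j).+1%:R * (M + j)%:R - M.+1%:R * M%:R) / 2) <= E M - E (M + j)%N.
  elim: j => [|j IH]; first by rewrite addn0 !subrr mul0r mulr0.
  rewrite addnS; have := ES (M + j)%N; move: IH (d0 (M + j)%N) (dS (M + j)%N).
  rewrite -!(natr1 (M + j).+1) -!(natr1 (M + j)) natrD -!(natr1 M).
  move: (d (M + j).+1) (d (M + j)%N) (ler0n R M) (ler0n R j).
  move: (M%:R) (j%:R) => m i d2 d1 m0 i0 IH d1_ge0 d21 ES1.
  set S := (m + i + 1) * (m + i) - (m + 1) * m in IH.
  have S0 : 0 <= S + 2 * (m + i + 1) by rewrite /S; nra.
  have -> : (m + i + 1 + 1) * (m + i + 1) - (m + 1) * m = S + 2 * (m + i + 1).
    by rewrite /S; ring.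
  have : c * d2 * ((S + 2 * (m + i + 1)) / 2) <= c * d1 * ((S + 2 * (m + i + 1)) / 2).
    apply: ler_wpM2r; first by rewrite divr_ge0.
    by apply: ler_wpM2l d21; exact: ltW.
  by move: IH ES1; lra.
have Elb : has_inf (range E).
  by split; [exists (E 0%N), 0%N|exists 0 => _ [k _ <-]].
apply/cvgrPdist_lt => e e0.
(* For [N >= 2 * M + 1] that sum is at least [(N + 1) ^ 2 / 8], whence the 8. *)
have ce : 0 < c * e / 8 by rewrite divr_gt0 ?mulr_gt0.
have [_ [M _ <-] EM] := inf_adherent ce Elb.
exists (M.*2.+1) => // N /= MN.
rewrite sub0r normrN ger0_norm ?mulr_ge0 ?exprn_ge0//.
have NE : (M + (N - M))%N = N.
  by rewrite subnKC// (leq_trans _ MN)// -addnn leqW// leq_addr.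
have := tail M (N - M)%N; rewrite NE.
have : inf (range E) <= E N by apply: ge_inf; [exact: Elb.2|exists N].
move: EM (d0 N) => + dN EN.
have : (M.*2.+1%:R : R) <= N%:R by rewrite ler_nat.
rewrite -addnn -[(M + M).+1]addn1 !natrD -(natr1 N) -(natr1 M).
move: (N%:R : R) (M%:R : R) (ler0n R M) => a m m0 am EM.
set S := (a + 1) * a - _ => tl.
have S8 : (a + 1) ^+ 2 / 4 <= S by rewrite /S; nra.
have : c * d N * ((a + 1) ^+ 2 / 4 / 2) <= c * d N * (S / 2).
  apply: ler_wpM2l; first by rewrite mulr_ge0// ltW.
  by apply: ler_wpM2r; rewrite ?invr_ge0.
move=> H; rewrite -(ltr_pM2l c0); lra.
Qed.

(** * The energy estimate along the iterates *)

Theorem theorem6 (R : realType) (n : nat) (hn : (1 <= n)%N) (L : R) (hL : 0 < L)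
    (f : 'rV[R]_n -> R) (f_convex : convex_function setT f)
    (f_smooth : L_smooth L f)
    (h : 'rV[R]_n -> \bar R) (h_proper : proper_fun h)
    (h_lsc : lower_semicontinuous h) (h_convex : econvex h)
    (xstar : 'rV[R]_n) (xstar_min : argmin (composite f h) xstar)
    (Fstar : \bar R) (FstarE : Fstar = composite f h xstar)
    (Fstar_gtNy : (-oo < Fstar)%E)
    (p : R) (hp : 3 <= p)
    (x y z x' x'' g' : nat -> 'rV[R]_n)
    (x_NSA : NSA f h L^-1 (fun k => p / (k%:R + p)) x y z x' x'' g') :
  ((k%:R ^+ 2)%:E * (composite f h (x k) - Fstar))%E @[k --> \oo] --> 0%E.
Proof.
set alpha := fun k => _ in x_NSA.
have [_ _ step] := x_NSA.
have p0 : 0 < p by apply: lt_le_trans hp.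
have [Fs FsE] := composite_argmin_fin h_proper xstar_min.
have pg y :=
  prox_gradient_step hL f_convex f_smooth h_proper h_lsc h_convex xstar_min y.
have fin k : exists r, composite f h (x k.+1) = r%:E.
  have [_ [E' E''] -> _ _] := step k; case: ifP => _.
  - by rewrite E'; have [r] := pg (y k); exists r.
  - by rewrite E''; have [r] := pg (x k); exists r.
(* Index shift: [Fr k] is the objective at [x k.+1], finite because that point is a prox output. *)
have [Fr FrE] := choice fin.
have xle k r' r'' : composite f h (x' k.+1) = r'%:E ->
    composite f h (x'' k.+1) = r''%:E -> Fr k <= r' /\ Fr k <= r''.
  move=> E' E''; have := FrE k; have [_ _ -> _ _] := step k.
  rewrite E' E'' lee_fin; case: leP => [?|/ltW ?]; rewrite ?E' ?E'' => -[<-] //.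
(* [d k] and [E k] are the gap and the energy at index [k.+1]; the factor of [d k] in [E k] is the
   inverse square of [alpha k]. *)
pose d k := Fr k - Fs.
pose E k := (k%:R + p) ^+ 2 / p ^+ 2 * d k
  + L / 2 * dot (z k.+1 - xstar) (z k.+1 - xstar).
have d_ge0 k : 0 <= d k.
  by rewrite subr_ge0 -lee_fin -FsE -FrE; exact: xstar_min.
have dS k : d k.+1 <= d k.
  rewrite lerD2r; have [_ [E' E''] _ _ _] := step k.+1.
  (* Taking [w] equal to the base point [x k.+1] kills the linear term, so [x'' k.+2] does not
     increase the objective. *)
  have [r' Er' _] := pg (y k.+1); have [r'' Er'' /(_ _ _ (FrE k))] := pg (x k.+1).
  rewrite -E' in Er'; rewrite -E'' in Er'' *.
  have [_ le_r''] := xle _ _ _ Er' Er''.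
  rewrite subrr -[X in dot _ X](scale0r 0) dotZr mul0r mulr0 addr0.
  have := mulr_ge0 (divr_ge0 (ltW hL) (ler0n R 2)) (dot_ge0 (x k.+1 - x'' k.+2)).
  by lra.
have ES k : E k.+1 + (p ^+ 2)^-1 * k.+1%:R * d k <= E k.
  have [Ey [E' E''] _ Eg Ez] := step k.+1.
  have [r'' Er'' _] := pg (x k.+1).
  have [r' Er' r'P] := pg (y k.+1).
  have H1 := r'P _ _ (FrE k); have H2 := r'P _ _ FsE.
  rewrite -E' in Er' H1 H2; rewrite -E'' in Er''.
  have [le_r' _] := xle _ _ _ Er' Er''.
  set a := alpha k.+1 in Ey Ez.
  have kp : 0 < k.+1%:R + p by rewrite ltr_wpDl.
  have a0 : 0 < a by rewrite divr_gt0.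
  have a1 : 0 <= 1 - a by rewrite subr_ge0 ler_pdivrMr// mul1r lerDr.
  set u := y k.+1 - x' k.+2 in H1 H2.
  set v := z k.+1 - xstar.
  (* Eliminating [g'] through its defining equation turns the update of [z] into a step along
     [u]. *)
  have zE : z k.+2 - xstar = v - a^-1 *: u.
    rewrite /v /u Ez.
    have -> : (L^-1 / a) *: g' k.+2 = a^-1 *: (L^-1 *: g' k.+2).
      by rewrite scalerA mulrC.
    by rewrite Eg; apply/rowP => i; rewrite !mxE; field; rewrite !gt_eqF.
  (* Since [y k.+1] averages [x k.+1] and [z k.+1], the two linear terms merge into one along
     [v]. *)
  have uv : (1 - a) * dot u (y k.+1 - x k.+1) + a * dot u (y k.+1 - xstar)
      = a * dot u v.
    rewrite -!dotZr -dotDr; congr dot.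
    by rewrite /v Ey; apply/rowP => i; rewrite !mxE; ring.
  have zz : L / 2 * dot (z k.+2 - xstar) (z k.+2 - xstar) =
     L / 2 * dot v v - L / a * dot u v + L / 2 / a ^+ 2 * dot u u.
    rewrite zE; clearbody u v; rewrite !dotE (dotC v u); field.
    by rewrite gt_eqF.
  pose b := k.+1%:R + p.
  have aE : a^-1 = b / p by rewrite /a /alpha invf_div.
  have main : Fr k.+1 <=
      (1 - a) * Fr k + a * Fs + L * a * dot u v - L / 2 * dot u u.
    move: H1 H2 => /(ler_wpM2l a1) H1 /(ler_wpM2l (ltW a0)) H2.
    have -> : L * a * dot u v = L * (a * dot u v) by rewrite mulrA.
    by rewrite -uv; lra.
  have b0 : b != 0 by rewrite gt_eqF.
  have pn0 : p != 0 by rewrite gt_eqF.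
  (* After division by [a ^+ 2], the terms in [dot u v] and [dot u u] match those of [zz] and
     cancel. *)
  have {}main : b ^+ 2 / p ^+ 2 * d k.+1 +
        L / 2 * dot (z k.+2 - xstar) (z k.+2 - xstar)
      <= k.+1%:R * b / p ^+ 2 * d k + L / 2 * dot v v.
    rewrite zz; have := ler_wpM2l (sqr_ge0 a^-1) main.
    have -> : (a^-1) ^+ 2 *
        ((1 - a) * Fr k + a * Fs + L * a * dot u v - L / 2 * dot u u)
      = b ^+ 2 / p ^+ 2 * Fs + k.+1%:R * b / p ^+ 2 * d k
        + L / a * dot u v - L / 2 / a ^+ 2 * dot u u.
      rewrite /d [in RHS](_ : k.+1%:R = b - p); last by rewrite /b addrK.
      by rewrite -[a]invrK aE; field; rewrite b0 pn0.
    by rewrite aE expr_div_n /d; lra.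
  (* The coefficients of [d k] on the right and in the first term on the left differ by
     [((k + 1) (p - 2) + (p - 1) ^ 2) / p ^ 2], which is at least [(k + 1) / p ^ 2] as [p >= 3]. *)
  have slack : k.+1%:R * b / p ^+ 2 * d k + (p ^+ 2)^-1 * k.+1%:R * d k
      <= (k%:R + p) ^+ 2 / p ^+ 2 * d k.
    rewrite -mulrDl; apply: ler_wpM2r => //.
    rewrite [_^-1 * _]mulrC -mulrDl; apply: ler_wpM2r.
      by rewrite invr_ge0 sqr_ge0.
    by rewrite /b -natr1; have := ler0n R k; nra.
  by rewrite /E -/v -/b; lra.
have dlim : k.+1%:R ^+ 2 * d k @[k --> \oo] --> 0.
  apply: (sqr_weighted_cvg0 _ d_ge0 _ dS ES); first by rewrite invr_gt0 exprn_gt0.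
  move=> k; apply: addr_ge0; apply: mulr_ge0.
  - by apply: divr_ge0; exact: sqr_ge0.
  - exact: d_ge0.
  - by apply: divr_ge0; [exact: ltW|exact: ler0n].
  - exact: dot_ge0.
(* Dropping index 0 leaves the limit unchanged and makes all values real. *)
rewrite FstarE FsE -cvg_shiftS/=.
rewrite (_ : (fun k => _) = (fun k => (k.+1%:R ^+ 2 * d k)%:E)); last first.
  by apply/funext => k; rewrite FrE -EFinB -EFinM.
by apply: cvg_EFin => //; exact: nearW.
Qed.
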